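(* Let $(X,d,A)$ be a metric pair such that $(X,d)$ is a length space, and let $p\in[1,\infty]$. Then $(\overline{D}_p(X,A),W_p)$ and $(D(X,A),W_p)$ are length spaces.
   Context: A metric on $X$ is a map $d:X\times X\to[0,\infty]$ with $d(x,x)=0$, symmetry and the triangle inequality (infinite distances allowed, $d(x,y)=0$ need not imply $x=y$); a metric pair $(X,d,A)$ is such a space with a closed subset $A$. Write $d(x,A)=\inf_{a\in A}d(x,a)$, $A^\delta=\{x:d(x,A)<\delta\}$ for $\delta\in(0,\infty]$. $\overline{D}(X,A)$ is the set of countable formal sums $\hat\alpha=\sum_{i\in I}x_i$ of points of $X\setminus A$ (repetitions allowed); $D(X,A)$ the finite ones; $0$ the empty sum. A matching of $\hat\alpha=\sum_{i\in I}x_i$, $\hat\beta=\sum_{j\in J}y_j$ is a formal sum $\sum_{k\in K}(x_k,y_{\varphi(k)})+\sum_{i\in I\setminus K}(x_i,z_i)+\sum_{j\in J\setminus\varphi(K)}(w_j,y_j)$ with $K\subset I$, $\varphi:K\to J$ injective, $z_i,w_j\in A$; its $p$-cost is the $\ell^p$ norm (sup norm if $p=\infty$) of the distances of paired points; $W_p(\alpha,\beta)$ is the infimum of $p$-costs over matchings. $u_\delta(\alpha)$ is the restriction of $\hat\alpha$ to $X\setminus A^\delta$ and $\ell_\delta(\alpha)$ the restriction to $A^\delta\setminus A$. For $p<\infty$, $\overline{D}_p(X,A)=\{\alpha: |u_\infty(\alpha)|<\infty,\ W_p(\ell_\infty(\alpha),0)<\infty\}$; $\overline{D}_\infty(X,A)=\{\alpha:|u_\delta(\alpha)|<\infty\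 \forall\delta>0\}$. The length of a path $\gamma:[0,1]\to X$ is $L_d(\gamma)=\sup\sum_{n=1}^N d(\gamma(t_{n-1}),\gamma(t_n))$ over all partitions $0=t_0<\dots<t_N=1$; $\gamma$ is rectifiable if $L_d(\gamma)<\infty$. A metric space is a length space if for all $x,y$ with $d(x,y)<\infty$, $d(x,y)=\inf L_d(\gamma)$ over rectifiable paths $\gamma$ from $x$ to $y$. *)

(* Defs.v *)
From HB Require Import structures.
From mathcomp Require Import all_boot all_order all_algebra.
From mathcomp Require Import all_classical all_reals all_analysis.
Set Implicit Arguments. Unset Strict Implicit. Unset Printing Implicit Defensive.
Import Order.TTheory GRing.Theory Num.Theory.
Local Open Scope classical_set_scope.
Local Open Scope ring_scope.

Section Defs.
Context {R : realType}.
Local Open Scope ereal_scope.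

(* A metric in the sense of the paper: values in [0, +oo], d x x = 0,
   symmetric, triangle inequality; d x y = 0 need not imply x = y. *)
Definition is_metric {X : Type} (d : X -> X -> \bar R) : Prop :=
  [/\ (forall x y, 0 <= d x y),
      (forall x, d x x = 0),
      (forall x y, d x y = d y x) &
      (forall x y z, d x z <= d x y + d y z)].

(* d(x, A) = inf_{a in A} d(x, a)  (= +oo if A is empty) *)
Definition dist_set {X : Type} (d : X -> X -> \bar R) (A : set X) (x : X) : \bar R :=
  ereal_inf [set d x a | a in A].

Definition closed_for {X : Type} (d : X -> X -> \bar R) (A : set X) : Prop :=
  forall x, (forall e : R, (0 < e)%R -> exists2 a, A a & d x a < e%:E) -> A x.

Definition unit_int (t : R) : Prop := (0 <= t <= 1)%R.

Definition is_path_in {T : Type} (dist : T -> T -> \bar R) (S : set T)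
  (g : R -> T) : Prop :=
  (forall t, unit_int t -> S (g t)) /\
  (forall t, unit_int t -> forall e : R, (0 < e)%R ->
     exists2 del : R, (0 < del)%R &
       forall s, unit_int s -> (`|s - t| < del)%R -> dist (g s) (g t) < e%:E).

Definition path_length {T : Type} (dist : T -> T -> \bar R) (g : R -> T) : \bar R :=
  ereal_sup [set v | exists (N : nat) (t : nat -> R),
    [/\ t 0%N = 0%R, t N = 1%R,
        (forall n, (n < N)%N -> (t n < t n.+1)%R) &
        v = \sum_(0 <= n < N) dist (g (t n)) (g (t n.+1))]].

Definition length_space {T : Type} (S : set T) (dist : T -> T -> \bar R) : Prop :=
  forall x y, S x -> S y -> dist x y < +oo ->
    dist x y = ereal_inf [set path_length dist g | g in
      [set g | is_path_in dist S g /\ g 0%R = x /\ g 1%R = y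
               /\ path_length dist g < +oo]].

(* A countable formal sum sum_{i in I} x_i is represented by an index set
   I (a subset of nat, any countable index set being in bijection with one)
   and a family of points (values outside I are irrelevant). *)
Record fsum (X : Type) := FSum { fs_idx : set nat ; fs_pt : nat -> X }.

Definition Dbar {X : Type} (A : set X) : set (fsum X) :=
  [set al | forall i, fs_idx al i -> ~ A (fs_pt al i)].

Definition Dfin {X : Type} (A : set X) : set (fsum X) :=
  [set al | Dbar A al /\ finite_set (fs_idx al)].

(* l^p norm (p in [1, oo]) of the formal sum of distances of a matching,
   given as three families indexed by K, I \ K and J \ phi(K). *)
Definition lp_cost (p : \bar R) (K I' J' : set nat) (c1 c2 c3 : nat -> \bar R)
  : \bar R :=
  match p with
  | r%:E => poweR ((\esum_(k in K) poweR (c1 k) r)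
                 + (\esum_(i in I') poweR (c2 i) r)
                 + (\esum_(j in J') poweR (c3 j) r)) r^-1
  | _ => ereal_sup ([set 0] `|` (c1 @` K) `|` (c2 @` I') `|` (c3 @` J'))
  end.

(* the matching sum_{k in K} (x_k, y_phi(k)) + sum_{i in I\K} (x_i, z_i)
   + sum_{j in J \ phi(K)} (w_j, y_j) *)
Definition is_matching {X : Type} (A : set X) (al be : fsum X)
  (K : set nat) (phi : nat -> nat) (z w : nat -> X) : Prop :=
  [/\ K `<=` fs_idx al,
      (forall k1 k2, K k1 -> K k2 -> phi k1 = phi k2 -> k1 = k2),
      (forall k, K k -> fs_idx be (phi k)),
      (forall i, (fs_idx al `\` K) i -> A (z i)) &
      (forall j, (fs_idx be `\` phi @` K) j -> A (w j))].

Definition matching_cost {X : Type} (d : X -> X -> \bar R) (p : \bar R)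
  (al be : fsum X) (K : set nat) (phi : nat -> nat) (z w : nat -> X) : \bar R :=
  lp_cost p K (fs_idx al `\` K) (fs_idx be `\` phi @` K)
    (fun k => d (fs_pt al k) (fs_pt be (phi k)))
    (fun i => d (fs_pt al i) (z i))
    (fun j => d (w j) (fs_pt be j)).

Definition Wp {X : Type} (d : X -> X -> \bar R) (A : set X) (p : \bar R)
  (al be : fsum X) : \bar R :=
  ereal_inf [set c | exists K phi z w,
    is_matching A al be K phi z w /\ c = matching_cost d p al be K phi z w].

Definition u_res {X : Type} (d : X -> X -> \bar R) (A : set X) (del : \bar R)
  (al : fsum X) : fsum X :=
  FSum [set i | fs_idx al i /\ del <= dist_set d A (fs_pt al i)] (fs_pt al).

Definition l_res {X : Type} (d : X -> X -> \bar R) (A : set X) (del : \bar R)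
  (al : fsum X) : fsum X :=
  FSum [set i | fs_idx al i /\ dist_set d A (fs_pt al i) < del] (fs_pt al).

Definition zero_like {X : Type} (al : fsum X) : fsum X := FSum set0 (fs_pt al).

Definition Dbar_p {X : Type} (d : X -> X -> \bar R) (A : set X) (p : \bar R)
  : set (fsum X) :=
  match p with
  | r%:E => [set al | Dbar A al
               /\ finite_set (fs_idx (u_res d A +oo al))
               /\ Wp d A p (l_res d A +oo al) (zero_like al) < +oo]
  | _ => [set al | Dbar A al /\
               forall del : R, (0 < del)%R -> finite_set (fs_idx (u_res d A del%:E al))]
  end.

End Defs.

(* Main.v *)
Require Import Defs.
From HB Require Import structures.
From mathcomp Require Import all_boot all_order all_algebra.
From mathcomp Require Import all_classical all_reals all_analysis.
From mathcomp Require Import lra.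
Import Order.TTheory GRing.Theory Num.Theory.
Local Open Scope classical_set_scope.
Local Open Scope ereal_scope.

(* Given an almost optimal matching, join each matched pair by an almost shortest
   path of [X] parametrised proportionally to arc length, and move all the points
   along these paths simultaneously, discarding a point whenever it lies in [A].
   Between two times [s] and [t] the [m]-th point moves by at most [L m * |s - t|],
   so this is a Lipschitz path of formal sums whose constant, hence length, is at
   most the l^p norm of [L], which is close to the cost of the matching.
   It remains to see that the path stays in the given space of formal sums. This
   needs care only for [p = +oo], where a pair of points close to [A] may be joined
   by a path going far away from [A]: there the matching is first modified so that
   its costs tend to [0]. *)

(** * Lipschitz paths in a length space *)

Section LipschitzPaths.
Context {R : realType} {X : Type} (d : X -> X -> \bar R).
Hypothesis dM : is_metric d.

Let d_ge0 x y : 0 <= d x y. Proof. by case: dM. Qed.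
Let dxx x : d x x = 0. Proof. by case: dM. Qed.
Let dC x y : d x y = d y x. Proof. by case: dM. Qed.
Let d_tri x y z : d x z <= d x y + d y z. Proof. by case: dM. Qed.

(** The variable endpoint lets arc length serve as a parameter; at [u = 1] this is convertible to
    [path_length d g]. *)
Definition length_upto (g : R -> X) (u : R) : \bar R :=
  ereal_sup [set v | exists (N : nat) (t : nat -> R),
    [/\ t 0%N = 0%R, t N = u,
        (forall n, (n < N)%N -> (t n < t n.+1)%R) &
        v = \sum_(0 <= n < N) d (g (t n)) (g (t n.+1))]].

Lemma length_upto_ge0 g u : (0 <= u)%R -> 0 <= length_upto g u.
Proof.
rewrite le_eqVlt => /predU1P[<-|u0]; apply: ereal_sup_ge.
  exists 0 => //; exists 0%N, (fun=> 0%R); split=> //.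
  by rewrite big_geq.
exists (d (g 0%R) (g u)) => //.
by exists 1%N, (fun n => if n is 0%N then 0%R else u); split=> // [[]//|]; rewrite big_nat1.
Qed.

(** Appending [s'] to a partition of [[0, s]] gives one of [[0, s']]. The supremum is taken after
    subtracting [d (g s) (g s')], so an infinite distance is treated apart. *)
Lemma length_upto_step g s s' : (0 <= s)%R -> (s < s')%R ->
  length_upto g s + d (g s) (g s') <= length_upto g s'.
Proof.
move=> s0 ss'.
have step v : [set v | exists (N : nat) (t : nat -> R),
    [/\ t 0%N = 0%R, t N = s,
        (forall n, (n < N)%N -> (t n < t n.+1)%R) &
        v = \sum_(0 <= n < N) d (g (t n)) (g (t n.+1))]] v ->
    v + d (g s) (g s') <= length_upto g s'.
  move=> [N [t [t0 tN tlt ->]]]; apply: ereal_sup_ubound.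
  exists N.+1, (fun n => if (n <= N)%N then t n else s'); split=> //.
  - by rewrite ltnn.
  - move=> n; rewrite ltnS => nN'.
    have /predU1P[->|nN] : (n == N) || (n < N)%N by rewrite -leq_eqVlt.
      by rewrite leqnn ltnn tN.
    by rewrite nN (ltnW nN) tlt.
  - rewrite big_nat_recr//= leqnn ltnn tN; congr (_ + _).
    by apply: eq_big_nat => n /andP[_ nN]; rewrite nN ltnW.
have [dfin|] := boolP (d (g s) (g s') \is a fin_num).
  rewrite -leeBrDr//; apply: ge_ereal_sup => v Sv.
  by rewrite leeBrDr//; exact: step.
rewrite ge0_fin_numE// -leNgt leye_eq => /eqP ddoo.
have := length_upto_ge0 g s s0; rewrite ddoo => Ls0.
suff -> : length_upto g s' = +oo by rewrite leey.
apply/eqP; rewrite -leye_eq.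
(* A single partition of [[0, s]] suffices here. Partitions being strictly increasing, [s = 0]
   leaves only the one without steps. *)
have [s00|s00] := eqVneq s 0%R.
  have := step 0; rewrite ddoo add0e; apply.
  by exists 0%N, (fun=> 0%R); split=> //; rewrite big_geq.
have := step (d (g 0%R) (g s)); rewrite ddoo addey; last first.
  by rewrite gt_eqF// (lt_le_trans _ (d_ge0 _ _)).
apply.
have {}s00 : (0 < s)%R by rewrite lt_def s00.
by exists 1%N, (fun n => if n is 0%N then 0%R else s); split=> // [[]//|]; rewrite big_nat1.
Qed.

Lemma length_upto_homo g s s' : (0 <= s)%R -> (s <= s')%R ->
  length_upto g s <= length_upto g s'.
Proof.
move=> s0; rewrite le_eqVlt => /predU1P[->//|ss'].
by apply: le_trans (length_upto_step g s s' s0 ss'); rewrite leeDl.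
Qed.

(* Reparametrising at u |-> sup {t | length on [0, t] < u} is 1-Lipschitz: only
   the continuity of the path is needed, not that of its length function. *)
Lemma lipschitz_reparam (g : R -> X) (L : R) :
  is_path_in d setT g -> path_length d g < L%:E ->
  exists h : R -> X, [/\ h 0%R = g 0%R, h 1%R = g 1%R &
    forall s t, unit_int s -> unit_int t -> d (h s) (h t) <= (L * `|s - t|)%:E].
Proof.
move=> [_ gC] gL.
have L0 : (0 < L)%R.
  by rewrite -lte_fin (le_lt_trans _ gL)// (length_upto_ge0 g 1%R ler01).
(* The point [0] is added so that the supremum is over a nonempty set even for [u = 0]. *)
pose E u := [set t : R | t = 0%R \/ unit_int t /\ length_upto g t < u%:E].
have E0 u : E u 0%R by left.
have EU u t : E u t -> unit_int t.
  by case=> [->|[]//]; rewrite /unit_int lexx ler01.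
have Eub u : has_ubound (E u) by exists 1%R => t /EU /andP[].
pose sg u := sup (E u).
have sgI u : unit_int (sg u).
  apply/andP; split; first exact: ub_le_sup.
  by apply: ge_sup => [|t /EU /andP[]//]; exists 0%R.
have sg0 : sg 0%R = 0%R.
  apply/eqP; rewrite eq_le; have /andP[-> _] := sgI 0%R; rewrite andbT.
  apply: ge_sup; first by exists 0%R.
  by move=> t [->//|[/andP[t0 _]]]; rewrite ltNge length_upto_ge0.
have sg1 : sg L = 1%R.
  apply/eqP; rewrite eq_le; have /andP[_ ->] := sgI L; rewrite andTb.
  apply: ub_le_sup => //; right; split=> //.
  by rewrite /unit_int lexx ler01.
have sglt u s : (0 <= s)%R -> (s < sg u)%R -> length_upto g s < u%:E.
  move=> s0 /(sup_gt (ex_intro _ 0%R (E0 u)))[t [->|[tI tu]] st].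
    by rewrite ltNge s0 in st.
  exact: le_lt_trans (length_upto_homo g s t s0 (ltW st)) tu.
have sggt u s : unit_int s -> (sg u < s)%R -> u%:E <= length_upto g s.
  move=> sI; rewrite ltNge; apply: contraNT; rewrite -ltNge => su.
  by apply: ub_le_sup => //; right.
(* The length up to a point just after [sg u] is at least [u], and up to a point just before [sg u']
   it is less than [u'], so [length_upto_step] bounds the distance of their images by [u' - u].
   Continuity of [g] at [sg u] and [sg u'] costs [e] more; the midpoint [m] keeps the two points in
   order. *)
have key u u' : (u <= u')%R -> d (g (sg u)) (g (sg u')) <= (u' - u)%:E.
  move=> uu'.
  have : (sg u <= sg u')%R.
    apply: ge_sup => [|t Et]; first by exists 0%R.
    apply: ub_le_sup => //; case: Et => [->|[tI tu]]; [by left|right]; split=> //.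
    by rewrite (lt_le_trans tu)// lee_fin.
  rewrite le_eqVlt => /predU1P[->|sgu].
    by rewrite dxx lee_fin subr_ge0.
  apply/lee_addgt0Pr => e e0.
  have e20 : (0 < e / 2)%R by rewrite divr_gt0.
  have /andP[u0 u1] := sgI u; have /andP[u'0 u'1] := sgI u'.
  have [del1 del10 H1] := gC _ (sgI u) _ e20.
  have [del2 del20 H2] := gC _ (sgI u') _ e20.
  pose m := ((sg u + sg u') / 2)%R.
  have [um mu'] : (sg u < m)%R /\ (m < sg u')%R by split; rewrite /m; lra.
  have [s [us sm sd]] : exists s, [/\ (sg u < s)%R, (s < m)%R & (s - sg u < del1)%R].
    exists (sg u + Num.min (m - sg u) del1 / 2)%R.
    have : (0 < Num.min (m - sg u) del1)%R by rewrite lt_min del10 subr_gt0 um.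
    have : (Num.min (m - sg u) del1 <= m - sg u)%R by rewrite ge_min lexx.
    have : (Num.min (m - sg u) del1 <= del1)%R by rewrite ge_min lexx orbT.
    by split; lra.
  have [s' [s'u s'm s'd]] : exists s, [/\ (s < sg u')%R, (m < s)%R & (sg u' - s < del2)%R].
    exists (sg u' - Num.min (sg u' - m) del2 / 2)%R.
    have : (0 < Num.min (sg u' - m) del2)%R by rewrite lt_min del20 subr_gt0 mu'.
    have : (Num.min (sg u' - m) del2 <= sg u' - m)%R by rewrite ge_min lexx.
    have : (Num.min (sg u' - m) del2 <= del2)%R by rewrite ge_min lexx orbT.
    by split; lra.
  have sI : unit_int s by apply/andP; split; lra.
  have s'I : unit_int s' by apply/andP; split; lra.
  have {H1}d1 : d (g s) (g (sg u)) < (e / 2)%:E.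
    by apply: H1 => //; rewrite ger0_norm; lra.
  have {H2}d2 : d (g s') (g (sg u')) < (e / 2)%:E.
    by apply: H2 => //; rewrite ler0_norm; lra.
  have d3 : d (g s) (g s') <= (u' - u)%:E.
    rewrite EFinB leeBrDr// addeC.
    apply: le_trans (leeD2r _ (sggt u s sI us)) _.
    apply: le_trans (length_upto_step g s s' _ _) _; [lra|lra|].
    by apply/ltW/sglt => //; lra.
  apply: le_trans (d_tri _ (g s) _) _.
  have -> : (u' - u)%:E + e%:E = (e / 2)%:E + ((u' - u)%:E + (e / 2)%:E).
    by rewrite -!EFinD; congr EFin; lra.
  apply: leeD; first by rewrite dC ltW.
  apply: le_trans (d_tri _ (g s') _) _.
  by apply: leeD => //; exact: ltW.
exists (fun u => g (sg (L * u)%R)); split; first by rewrite mulr0 sg0.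
  by rewrite mulr1 sg1.
move=> s t _ _; wlog st : s t / (s <= t)%R => [H|].
  have [/H//|/ltW/H] := leP s t.
  by rewrite dC distrC.
rewrite distrC ger0_norm ?subr_ge0// mulrBr; apply: key.
by rewrite ler_pM2l.
Qed.

(** Shortest paths need not exist, hence the strict inequality in the hypothesis. *)
Lemma lipschitz_path (x y : X) (L : R) :
  length_space setT d -> d x y < L%:E ->
  exists h : R -> X, [/\ h 0%R = x, h 1%R = y &
    forall s t, unit_int s -> unit_int t -> d (h s) (h t) <= (L * `|s - t|)%:E].
Proof.
move=> dL dxy.
have dxyoo : d x y < +oo by apply: lt_le_trans dxy _; rewrite leey.
move: dxy; rewrite (dL x y I I dxyoo) => /ereal_inf_lt[_ [g [gP [g0 [g1 _]]] <-]].
by move=> /(lipschitz_reparam g L gP); rewrite g0 g1.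
Qed.

End LipschitzPaths.

(** * Norms of families of costs *)

Section LpNorm.
Local Open Scope ring_scope.
Local Open Scope ereal_scope.
Context {R : realType}.
Implicit Types (p : \bar R) (K I J M : set nat) (a b c : nat -> \bar R).

(** One index set replaces the three of [lp_cost]. The added [0] gives the empty family norm [0]
    when [p = +oo]. *)
Definition lp_norm p M c : \bar R :=
  match p with
  | r%:E => poweR (\esum_(m in M) poweR (c m) r) r^-1
  | _ => ereal_sup ([set 0] `|` (c @` M))
  end.

Lemma esum_subset M M' a : M `<=` M' -> \esum_(m in M) a m <= \esum_(m in M') a m.
Proof.
move=> MM'; apply: ge_ereal_sup => _ [F [finF FM] <-].
by apply: ereal_sup_ubound; exists F => //; split=> //; exact: subset_trans MM'.
Qed.

Lemma esumU M M' a : [disjoint M & M'] -> (forall m, 0 <= a m) ->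
  \esum_(m in M `|` M') a m = \esum_(m in M) a m + \esum_(m in M') a m.
Proof.
move=> /disj_setPS MM' a0; rewrite (esumID M)//; congr (_ + _); congr (esum _ _).
  by apply/seteqP; split=> m; [case|split=> //; left].
apply/seteqP; split=> m; first by case=> -[].
by move=> M'm; split; [right|move=> Mm; exact: (MM' m)].
Qed.

Lemma le_esumZ M a (x : \bar R) : 0 <= x -> (forall m, 0 <= a m) ->
  \esum_(m in M) (x * a m) <= x * \esum_(m in M) a m.
Proof.
move=> x0 a0; apply: ge_ereal_sup => _ [F [finF FM] <-].
rewrite -ge0_mule_fsumr// lee_wpmul2l//.
by apply: ereal_sup_ubound; exists F.
Qed.

Lemma lep1 p : 1 <= p -> (exists2 r : R, (1 <= r)%R & p = r%:E) \/ p = +oo.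
Proof. by case: p => [r| |] // r1; [left; exists r|right]. Qed.

Lemma ler_poweR r (x y : \bar R) : (0 <= r)%R -> 0 <= x -> x <= y ->
  poweR x r <= poweR y r.
Proof.
move=> r0 x0 xy; apply: gt0_ler_poweR => //; rewrite in_itv/= leey andbT//.
exact: le_trans xy.
Qed.

Lemma poweRK r (x : \bar R) : (0 < r)%R -> 0 <= x -> poweR (poweR x r) r^-1 = x.
Proof. by move=> r0 x0; rewrite -poweRrM mulfV ?gt_eqF// poweRe1. Qed.

Lemma poweRVK r (x : \bar R) : (0 < r)%R -> 0 <= x -> poweR (poweR x r^-1) r = x.
Proof. by move=> r0 x0; rewrite -poweRrM mulVf ?gt_eqF// poweRe1. Qed.

(** The sum is at most twice the larger term. This serves to prove sums finite, where the constant
    does not matter. *)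
Lemma poweRD_le (r : R) (x y : \bar R) : (0 <= r)%R -> 0 <= x -> 0 <= y ->
  poweR (x + y) r <= poweR 2%:E r * (poweR x r + poweR y r).
Proof.
move=> r0 x0 y0.
wlog xy : x y x0 y0 / x <= y => [H|].
  have [/H|/ltW/H] := leP x y; first exact.
  by rewrite addeC (addeC (poweR x r)); exact.
apply: (@le_trans _ _ (poweR (2%:E * y) r)).
  apply: ler_poweR => //; first exact: adde_ge0.
  by rewrite mule_natl mule2n leeD2r.
rewrite poweRM// lee_wpmul2l ?poweR_ge0//.
by rewrite leeDr// poweR_ge0.
Qed.

Lemma lp_norm_ge0 p M c : 0 <= lp_norm p M c.
Proof.
by case: p => [r| |]; [exact: poweR_ge0|apply: ereal_sup_ubound; left..].
Qed.

Lemma lp_norm_le p M M' c c' : 1 <= p -> M `<=` M' ->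
  (forall m, 0 <= c m) -> (forall m, M m -> c m <= c' m) ->
  lp_norm p M c <= lp_norm p M' c'.
Proof.
move=> /lep1[[r r1 ->]|->] MM' c0 cc'.
  have r0 : (0 < r)%R by exact: lt_le_trans r1.
  apply: ler_poweR; first by rewrite invr_ge0 ltW.
    by apply: esum_ge0 => m _; exact: poweR_ge0.
  apply: le_trans (esum_subset _ _ _ MM'); apply: le_esum => m Mm.
  by apply: ler_poweR; [exact: ltW|exact: c0|exact: cc'].
apply: ge_ereal_sup => _ [->|[m Mm <-]].
  by apply: ereal_sup_ubound; left.
by apply: le_trans (cc' m Mm) _; apply: ereal_sup_ubound; right; exists m => //; exact: MM'.
Qed.

Lemma le_lp_norm p M c m : 1 <= p -> (forall m, 0 <= c m) -> M m ->
  c m <= lp_norm p M c.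
Proof.
move=> /lep1[[r r1 ->]|->] c0 Mm; last first.
  by apply: ereal_sup_ubound; right; exists m.
have r0 : (0 < r)%R by exact: lt_le_trans r1.
rewrite -[leLHS](poweRK r)//; apply: ler_poweR; first by rewrite invr_ge0 ltW.
  exact: poweR_ge0.
rewrite -(@esum_set1 R nat m (fun m => poweR (c m) r)); last exact: poweR_ge0.
by apply: esum_subset => _ ->.
Qed.

Lemma lp_norm_scale p M c l (k : R) : 1 <= p -> (0 <= k)%R ->
  (forall m, 0 <= c m) -> (forall m, 0 <= l m) ->
  (forall m, M m -> c m <= k%:E * l m) ->
  lp_norm p M c <= k%:E * lp_norm p M l.
Proof.
move=> /lep1[[r r1 ->]|->] k0 c0 l0 ckl.
  have r0 : (0 < r)%R by exact: lt_le_trans r1.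
  rewrite /lp_norm -[X in X * _](poweRK r)// -poweRM; last 2 first.
  - exact: poweR_ge0.
  - by apply: esum_ge0 => *; exact: poweR_ge0.
  apply: ler_poweR; first by rewrite invr_ge0 ltW.
    by apply: esum_ge0 => *; exact: poweR_ge0.
  apply: (@le_trans _ _ (\esum_(m in M) (poweR k%:E r * poweR (l m) r))).
    apply: le_esum => m Mm; rewrite -poweRM//.
    by apply: ler_poweR; [exact: ltW|exact: c0|exact: ckl].
  by apply: le_esumZ => [|m]; exact: poweR_ge0.
apply: ge_ereal_sup => _ [->|[m Mm <-]].
  by rewrite mule_ge0// lp_norm_ge0.
apply: le_trans (ckl m Mm) _; rewrite lee_wpmul2l//.
by apply: ereal_sup_ubound; right; exists m.
Qed.

Lemma eq_lp_cost p K I J a b c a' b' c' :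
  (forall k, K k -> a k = a' k) -> (forall i, I i -> b i = b' i) ->
  (forall j, J j -> c j = c' j) ->
  lp_cost p K I J a b c = lp_cost p K I J a' b' c'.
Proof.
move=> aa' bb' cc'.
have imE (T : Type) (S : set nat) (u v : nat -> T) :
    (forall s, S s -> u s = v s) -> u @` S = v @` S.
  by move=> uv; apply/seteqP; split=> _ [s Ss <-]; exists s => //; rewrite uv.
rewrite /lp_cost (imE _ K a a')// (imE _ I b b')// (imE _ J c c')//.
case: p => // r; congr (poweR (_ + _ + _) _); apply: eq_esum => s Ss.
- by rewrite aa'.
- by rewrite bb'.
- by rewrite cc'.
Qed.

(** Injections with disjoint images reindex the three sums or suprema of a matching cost over one
    index set. This is the bridge between matchings and families, crossed in both directions
    below. *)
Lemma lp_cost_images p K I J (f g h : nat -> nat) c :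
  set_inj K f -> set_inj I g -> set_inj J h ->
  [disjoint f @` K & g @` I] -> [disjoint f @` K `|` g @` I & h @` J] ->
  (forall m, 0 <= c m) ->
  lp_cost p K I J (c \o f) (c \o g) (c \o h) =
  lp_norm p (f @` K `|` g @` I `|` h @` J) c.
Proof.
move=> fI gI hI fg fgh c0; rewrite /lp_cost /lp_norm.
case: p => [r| |]; rewrite ?image_setU ?image_comp ?setUA//.
have p0 m : 0 <= poweR (c m) r by exact: poweR_ge0.
by congr (poweR _ _); rewrite esumU// esumU// !esum_image.
Qed.

Lemma sum_geometric_le (e : R) M : (0 <= e)%R ->
  \esum_(m in M) (e / (2 ^ m.+1)%:R)%:E <= e%:E.
Proof.
move=> e0; rewrite (_ : M = [set m | m \in M]); last first.
  by apply/seteqP; split=> m; rewrite /= inE.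
rewrite -nneseries_esum; first exact: epsilon_trick0.
by move=> m _; rewrite lee_fin divr_ge0// ler0n.
Qed.

(** The perturbation acts on [r]-th powers, where the norm becomes a sum: the gap [h] between the
    [r]-th powers of [n + e] and [n] is shared out in portions [h / 2 ^ (m + 1)], which make every
    inequality strict and add up to at most [h]. *)
Lemma lp_norm_perturb (r : R) M c (e : R) : (1 <= r)%R ->
  (forall m, 0 <= c m) -> lp_norm r%:E M c < +oo -> (0 < e)%R ->
  exists L : nat -> R, [/\ forall m, M m -> c m < (L m)%:E,
    forall m, (0 <= L m)%R & lp_norm r%:E M (EFin \o L) <= lp_norm r%:E M c + e%:E].
Proof.
move=> r1 c0 cfin e0.
have r0 : (0 < r)%R by exact: lt_le_trans r1.
have S0 : 0 <= \esum_(m in M) poweR (c m) r by apply: esum_ge0 => *; exact: poweR_ge0.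
have nfin : lp_norm r%:E M c \is a fin_num by rewrite ge0_fin_numE ?lp_norm_ge0.
pose n := fine (lp_norm r%:E M c).
have nE : lp_norm r%:E M c = n%:E by rewrite fineK.
have n0 : (0 <= n)%R by rewrite -lee_fin -nE lp_norm_ge0.
have SE : \esum_(m in M) poweR (c m) r = (n `^ r)%:E.
  by rewrite -poweR_EFin -nE /lp_norm poweRVK.
have cE m : M m -> c m = (fine (c m))%:E.
  move=> Mm; rewrite fineK// ge0_fin_numE//; apply: le_lt_trans cfin.
  by apply: le_lp_norm.
pose h := ((n + e) `^ r - n `^ r)%R.
have h0 : (0 < h)%R.
  rewrite subr_gt0; apply: gt0_ltr_powR => //; rewrite ?nnegrE//; lra.
pose s m := (fine (c m) `^ r + h / (2 ^ m.+1)%:R)%R.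
have hm0 m : (0 < h / (2 ^ m.+1)%:R)%R by rewrite divr_gt0// ltr0n expn_gt0.
have s0 m : (0 <= s m)%R by rewrite addr_ge0 ?powR_ge0// ltW.
exists (fun m => (s m `^ r^-1)%R); split.
- move=> m Mm; rewrite cE// lte_fin.
  have f0 : (0 <= fine (c m))%R by rewrite -lee_fin -cE.
  rewrite -[ltLHS]powRr1// -(mulfV (lt0r_neq0 r0)) powRrM.
  apply: gt0_ltr_powR; rewrite ?invr_gt0 ?nnegrE ?powR_ge0//.
  by rewrite ltrDl.
- by move=> m; exact: powR_ge0.
rewrite nE -EFinD -[leRHS](poweRK r)//; last by rewrite lee_fin addr_ge0// ltW.
apply: ler_poweR; first by rewrite invr_ge0 ltW.
  by apply: esum_ge0 => *; exact: poweR_ge0.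
apply: (@le_trans _ _ (\esum_(m in M) (poweR (c m) r + (h / (2 ^ m.+1)%:R)%:E))).
  apply: le_esum => m Mm /=.
  by rewrite -powRrM mulVf ?gt_eqF// powRr1// cE.
rewrite esumD; last 2 first.
- by move=> *; exact: poweR_ge0.
- by move=> m _; rewrite lee_fin ltW.
rewrite SE; apply: le_trans (leeD2l _ (sum_geometric_le h M (ltW h0))) _.
by rewrite -EFinD poweR_EFin lee_fin /h addrC subrK.
Qed.

(* The extra length allotted to the [m]-th path tends to [0] with [m], so that
   costs tending to [0] still do so after the perturbation. *)
Lemma sup_norm_perturb M c (e : R) :
  (forall m, 0 <= c m) -> lp_norm +oo M c < +oo -> (0 < e)%R ->
  (forall del : R, (0 < del)%R -> finite_set [set m | M m /\ del%:E <= c m]) ->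
  exists L : nat -> R, [/\ forall m, M m -> c m < (L m)%:E,
    forall m, (0 <= L m)%R, lp_norm +oo M (EFin \o L) <= lp_norm +oo M c + e%:E &
    forall del : R, (0 < del)%R -> finite_set [set m | M m /\ (del <= L m)%R]].
Proof.
move=> c0 cfin e0 cvan.
have cE m : M m -> c m = (fine (c m))%:E.
  move=> Mm; rewrite fineK// ge0_fin_numE//; apply: le_lt_trans cfin.
  by apply: le_lp_norm => //; rewrite leey.
pose q m := (e / m.+1%:R)%R.
have q0 m : (0 < q m)%R by rewrite divr_gt0.
have f0 m : (0 <= fine (c m))%R by rewrite fine_ge0.
exists (fun m => fine (c m) + q m)%R; split.
- by move=> m Mm; rewrite cE// lte_fin ltrDl.
- by move=> m; rewrite addr_ge0// ltW.
- apply: ge_ereal_sup => _ [->|[m Mm <-]].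
    by rewrite adde_ge0 ?lp_norm_ge0// lee_fin ltW.
  rewrite /= EFinD -cE//; apply: leeD; first by apply: (@le_lp_norm +oo) => //; rewrite leey.
  by rewrite lee_fin ler_pdivrMr//; apply: ler_peMr; [exact: ltW|rewrite ler1n].
move=> del del0.
(* If [del <= c m + q m], one of the two terms is at least [del / 2]. For [q m] this forces
   [m <= 2 * e / del]. *)
have fin1 : finite_set [set m | (del / 2 <= q m)%R].
  apply: (@sub_finite_set _ _ `I_(Num.truncn (2 * e / del)).+1); last exact: finite_II.
  move=> m /= mq.
  have mq' : (m%:R <= 2 * e / del)%R.
    apply: (@le_trans _ _ m.+1%:R%R); first by rewrite ler_nat.
    rewrite ler_pdivlMr//; move: mq; rewrite /q ler_pdivlMr//; lra.
  rewrite ltnS leqNgt truncn_lt_nat -?leNgt//.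
  exact: le_trans (ler0n _ _) mq'.
have del20 : (0 < del / 2)%R by rewrite divr_gt0.
have := conj fin1 (cvan _ del20); rewrite -finite_setU; apply: sub_finite_set.
move=> m /= [Mm delL]; have [|mq] := leP (del / 2)%R (q m); first by left.
right; split=> //; rewrite cE// lee_fin; lra.
Qed.

End LpNorm.

(** * Families of points representing formal sums *)

Section Families.
Context {R : realType} {X : Type} (d : X -> X -> \bar R) (A : set X) (p : \bar R).
Hypotheses (dM : is_metric d) (p1 : 1 <= p).

Let d_ge0 x y : 0 <= d x y. Proof. by case: dM. Qed.

(* [e] identifies the formal sum [f] with the family [(P m)_(m in M)] from which
   the points lying in [A] are discarded. *)
Definition represents (f : fsum X) (M : set nat) (P : nat -> X) (e : nat -> nat) :=
  [/\ forall i, fs_idx f i -> M (e i) /\ ~ A (P (e i)),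
      forall i j, fs_idx f i -> fs_idx f j -> e i = e j -> i = j,
      forall m, M m -> ~ A (P m) -> exists2 i, fs_idx f i & e i = m &
      forall i, fs_idx f i -> fs_pt f i = P (e i)].

Lemma Wp_ge0 f f' : 0 <= Wp d A p f f'.
Proof.
apply: le_ereal_inf_tmp => _ [K [phi [z [w [_ ->]]]]]; rewrite /matching_cost.
case: p => [r| |]; [exact: poweR_ge0|apply: ereal_sup_ubound..]; by do 3 left.
Qed.

(** Points with the same index are paired if both lie off [A]. If just one lies in [A], it is the
    point of [A] to which the other is matched. *)
Lemma Wp_represents f f' M P Q e e' :
  represents f M P e -> represents f' M Q e' ->
  Wp d A p f f' <= lp_norm p M (fun m => d (P m) (Q m)).
Proof.
move=> [eM eI eS eP] [e'M e'I e'S e'P].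
have [phi phiP] : exists phi : nat -> nat, forall i,
    fs_idx f i -> ~ A (Q (e i)) -> fs_idx f' (phi i) /\ e' (phi i) = e i.
  suff /choice[phi phiP] : forall i, exists j,
      fs_idx f i -> ~ A (Q (e i)) -> fs_idx f' j /\ e' j = e i by exists phi.
  move=> i; have [[fi Qi]|nfi] := pselect (fs_idx f i /\ ~ A (Q (e i))).
    by have [j f'j e'j] := e'S _ (eM i fi).1 Qi; exists j.
  by exists 0%N => fi Qi; exfalso; apply: nfi.
pose K := [set i | fs_idx f i /\ ~ A (Q (e i))].
pose J := fs_idx f' `\` phi @` K.
have KE j i : fs_idx f' j -> fs_idx f i -> e i = e' j -> (phi @` K) j.
  move=> f'j fi eij; have [_ Qj] := e'M j f'j.
  have Qi : ~ A (Q (e i)) by rewrite eij.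
  exists i => //; have [f'p e'p] := phiP i fi Qi.
  by apply: e'I => //; rewrite e'p.
have matchK : is_matching A f f' K phi (Q \o e) (P \o e').
  split.
  - by move=> i [].
  - move=> i j [fi Qi] [fj Qj] ij; apply: eI => //.
    by rewrite -(phiP i fi Qi).2 -(phiP j fj Qj).2 ij.
  - by move=> i [fi Qi]; exact: (phiP i fi Qi).1.
  - by move=> i [fi nK] /=; apply: contrapT => Qi; exact: nK.
  - move=> j [f'j nK] /=; apply: contrapT => Pj.
    have [i fi eij] := eS _ (e'M j f'j).1 Pj.
    by apply: nK; exact: KE eij.
apply: (@le_trans _ _ (matching_cost d p f f' K phi (Q \o e) (P \o e'))).
  apply: ereal_inf_lbound.
  by exists K, phi, (Q \o e), (P \o e').
pose c m := d (P m) (Q m).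
have c0 m : 0 <= c m by exact: d_ge0.
rewrite /matching_cost (@eq_lp_cost _ p K _ _ _ _ _ (c \o e) (c \o e) (c \o e')); first last.
- by move=> j [f'j _]; rewrite /= e'P.
- by move=> i [fi _]; rewrite /= eP.
- move=> i [fi Qi]; have [f'p e'p] := phiP i fi Qi.
  by rewrite /= eP// e'P// e'p.
rewrite lp_cost_images//.
(* The three images may miss indices [m] for which both [P m] and [Q m] lie in [A]. *)
- apply: lp_norm_le => //.
  by move=> _ [[[i [fi _] <-]|[i [fi _] <-]]|[j [f'j _] <-]];
    [exact: (eM i fi).1|exact: (eM i fi).1|exact: (e'M j f'j).1].
- by move=> i j /set_mem[fi _] /set_mem[fj _]; exact: eI.
- by move=> i j /set_mem[fi _] /set_mem[fj _]; exact: eI.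
- by move=> i j /set_mem[fi _] /set_mem[fj _]; exact: e'I.
- apply/disj_setPS => _ [[i Ki <-] [j [fj nKj] /eI ji]].
  by apply: nKj; rewrite ji//; case: Ki.
- apply/disj_setPS => m [efm [j [f'j nKj] e'jm]].
  have [i fi eim] : exists2 i, fs_idx f i & e i = m.
    by case: efm => -[i [fi _] <-]; exists i.
  by apply: nKj; apply: (KE j i) => //; rewrite eim.
Qed.

(** By [Wp_represents] the path is Lipschitz with constant the norm of [L], and along a partition of
    [[0, 1]] these bounds telescope to that constant. *)
Lemma path_of_lipschitz_family (S : set (fsum X)) al be M (L : nat -> R)
    (G : nat -> R -> X) ea eb :
  S al -> S be ->
  represents al M (G ^~ 0%R) ea -> represents be M (G ^~ 1%R) eb ->
  (forall m, (0 <= L m)%R) ->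
  (forall m s t, M m -> unit_int s -> unit_int t ->
     d (G m s) (G m t) <= (L m * `|s - t|)%:E) ->
  (forall t, unit_int t -> S (FSum [set m | M m /\ ~ A (G m t)] (G ^~ t))) ->
  lp_norm p M (EFin \o L) < +oo ->
  exists g : R -> fsum X, [/\ is_path_in (Wp d A p) S g, g 0%R = al, g 1%R = be &
    path_length (Wp d A p) g <= lp_norm p M (EFin \o L)].
Proof.
move=> Sal Sbe rep0 rep1 L0 Glip GS Nfin.
(* The path must end at the records [al] and [be] themselves, whereas the family only represents
   them, with other indices. *)
pose g (t : R) := if t == 0%R then al else if t == 1%R then be else
  FSum [set m | M m /\ ~ A (G m t)] (G ^~ t).
have grep t : exists e, represents (g t) M (G ^~ t) e.
  rewrite /g; case: eqVneq => [->|_]; first by exists ea.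
  case: eqVneq => [->|_]; first by exists eb.
  by exists id; split=> //= m Mm Gm; exists m.
set N := lp_norm p M (EFin \o L) in Nfin *.
have N0 : 0 <= N by exact: lp_norm_ge0.
have NE : N = (fine N)%:E by rewrite fineK// ge0_fin_numE.
have glip s t : unit_int s -> unit_int t ->
    Wp d A p (g s) (g t) <= (`|s - t| * fine N)%:E.
  move=> sI tI; have [e re] := grep s; have [e' re'] := grep t.
  apply: le_trans (Wp_represents _ _ _ _ _ _ _ re re') _.
  rewrite EFinM -NE; apply: lp_norm_scale => //.
  by move=> m Mm; rewrite -EFinM mulrC; exact: Glip.
exists g; split.
- split=> [t tI|t tI e e0].
    by rewrite /g; case: ifP => // _; case: ifP => // _; exact: GS.
  have N10 : (0 < fine N + 1)%R by rewrite ltr_wpDl// fine_ge0.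
  exists (e / (fine N + 1))%R; first by rewrite divr_gt0.
  move=> s sI st; apply: le_lt_trans (glip s t sI tI) _; rewrite lte_fin.
  move: st; rewrite ltr_pdivlMr//; apply: le_lt_trans.
  by rewrite ler_wpM2l// lerDl.
- by rewrite /g eqxx.
- by rewrite /g oner_eq0 eqxx.
apply: ge_ereal_sup => _ [n [t [t0 tn tlt ->]]].
have tmono i j : (i <= j)%N -> (j <= n)%N -> (t i <= t j)%R.
  elim: j => [|j IH]; first by rewrite leqn0 => /eqP->.
  rewrite leq_eqVlt => /predU1P[->//|ij jn].
  by apply: le_trans (IH ij (ltnW jn)) (ltW (tlt _ jn)).
have tI i : (i <= n)%N -> unit_int (t i).
  by move=> ni; apply/andP; split; [rewrite -t0|rewrite -tn]; exact: tmono.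
apply: (@le_trans _ _ (\sum_(0 <= i < n) ((t i.+1 - t i) * fine N)%:E)).
  rewrite !big_mkord; apply: lee_sum => i _.
  apply: le_trans (glip _ _ (tI _ (ltnW (ltn_ord i))) (tI _ (ltn_ord i))) _.
  by rewrite distrC gtr0_norm// subr_gt0 tlt.
rewrite sumEFin -mulr_suml telescope_sumr// t0 tn subr0 mul1r.
by rewrite -NE.
Qed.

End Families.

(** * From matchings to paths *)

(** The one-step partition shows that a path is at least as long as the distance of its ends, so it
    remains to produce almost shortest paths. *)
Lemma length_spaceP {R : realType} {T : Type} (S : set T) (dist : T -> T -> \bar R) :
  (forall x y, 0 <= dist x y) ->
  (forall x y (e : R), S x -> S y -> dist x y < +oo -> (0 < e)%R ->
     exists g, [/\ is_path_in dist S g, g 0%R = x, g 1%R = y &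
       path_length dist g <= dist x y + e%:E]) ->
  length_space S dist.
Proof.
move=> dist0 H x y Sx Sy xyoo; apply/eqP; rewrite eq_le; apply/andP; split.
  apply: le_ereal_inf_tmp => _ [g [_ [g0 [g1 _]]] <-]; rewrite -g0 -g1.
  apply: ereal_sup_ubound; exists 1%N, (fun n => n%:R%R).
  by split=> // [n|]; rewrite ?big_nat1// ltr_nat.
apply/lee_addgt0Pr => e e0; have [g [gP g0 g1 gl]] := H x y e Sx Sy xyoo e0.
apply: le_trans (gl); apply: ereal_inf_lbound; exists g => //; split=> //.
do 2 split=> //; apply: le_lt_trans gl _.
by rewrite lte_add_pinfty// ltry.
Qed.

Section FamilyOfMatching.
Context {R : realType} {X : Type} (d : X -> X -> \bar R) (A : set X) (p : \bar R).
Hypotheses (dM : is_metric d) (p1 : 1 <= p).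

Let d_ge0 x y : 0 <= d x y. Proof. by case: dM. Qed.

(* Even indices carry the points of [al], odd ones the unmatched points of [be]. *)
Lemma family_of_matching al be K phi z w :
  Dbar A al -> Dbar A be -> is_matching A al be K phi z w ->
  exists M P Q e e', [/\ represents A al M P e, represents A be M Q e',
    lp_norm p M (fun m => d (P m) (Q m)) = matching_cost d p al be K phi z w &
    forall B : set (\bar R),
      finite_set [set k | K k /\ B (d (fs_pt al k) (fs_pt be (phi k)))] ->
      finite_set [set i | (fs_idx al `\` K) i /\ B (d (fs_pt al i) (z i))] ->
      finite_set [set j | (fs_idx be `\` phi @` K) j /\ B (d (w j) (fs_pt be j))] ->
      finite_set [set m | M m /\ B (d (P m) (Q m))]].
Proof.
move=> alA beA [KI phiI phiJ zA wA].
pose J := fs_idx be `\` phi @` K.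
pose M := [set m | if odd m then J m./2 else fs_idx al m./2].
pose P m := if odd m then w m./2 else fs_pt al m./2.
pose Q m := if odd m then fs_pt be m./2 else
  if `[< K m./2 >] then fs_pt be (phi m./2) else z m./2.
(* [T j m] says that the [j]-th point of [be] sits at index [m]: at an odd index if unmatched, at
   the index of its partner otherwise. [e'] chooses such an [m], which [Tinj] shows to be unique. *)
pose T j m := if odd m then J j /\ m./2 = j else K m./2 /\ phi m./2 = j.
have [e' e'T] : exists e' : nat -> nat, forall j, fs_idx be j -> T j (e' j).
  suff /choice[e' e'P] : forall j, exists m, fs_idx be j -> T j m by exists e'.
  move=> j; have [[k Kk kj]|nKj] := pselect ((phi @` K) j).
    by exists k.*2 => _; rewrite /T odd_double doubleK.
  by exists j.*2.+1 => bej; rewrite /T /= odd_double /= uphalf_double.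
have TM j m : T j m -> M m.
  rewrite /T /M /=; case: ifP => _ [] //.
    by move=> Jj ->.
  by move=> /KI.
have TQ j m : T j m -> Q m = fs_pt be j.
  rewrite /T /Q; case: ifP => _ []; first by move=> _ ->.
  by move=> Km <-; rewrite asboolT.
have Tfun j j' m : T j m -> T j' m -> j = j'.
  by rewrite /T; case: ifP => _ [_ <-] [_ <-].
have Tinj j m m' : T j m -> T j m' -> m = m'.
  have half : odd m = odd m' -> m./2 = m'./2 -> m = m'.
    by move=> oE hE; rewrite -(odd_double_half m) -(odd_double_half m') oE hE.
  rewrite /T; case: ifPn => om; case: ifPn => om' -[].
  - by move=> _ mj [_ m'j]; apply: half; [rewrite om om'|rewrite mj m'j].
  - by move=> [_ nKj] _ [Km' m'j]; exfalso; apply: nKj; exists m'./2.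
  - by move=> Km mj [[_ nKj] _]; exfalso; apply: nKj; exists m./2.
  - move=> Km mj [Km' m'j]; apply: half; first by rewrite (negbTE om) (negbTE om').
    by apply: phiI => //; rewrite mj.
pose c m := d (P m) (Q m).
have c0 m : 0 <= c m by exact: d_ge0.
have ME : M = double @` K `|` double @` (fs_idx al `\` K) `|` (fun j => j.*2.+1) @` J.
  apply/seteqP; split=> m; rewrite /M /=.
    case: ifPn => [om Jm|om alm].
      by right; exists m./2 => //; rewrite -[RHS]odd_double_half om.
    left; have mE : m./2.*2 = m by rewrite -[RHS]odd_double_half (negbTE om).
    by have [Km|nKm] := pselect (K m./2); [left|right]; exists m./2.
  move=> [[[k Kk <-]|[k [alk _] <-]]|[j Jj <-]];
    rewrite /= odd_double/= ?doubleK ?uphalf_double//.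
  exact: KI.
have cK k : K k -> d (fs_pt al k) (fs_pt be (phi k)) = c k.*2.
  by move=> Kk; rewrite /c /P /Q odd_double doubleK asboolT.
have cI i : (fs_idx al `\` K) i -> d (fs_pt al i) (z i) = c i.*2.
  by move=> [_ nKi]; rewrite /c /P /Q odd_double doubleK asboolF.
have cJ j : J j -> d (w j) (fs_pt be j) = c j.*2.+1.
  by move=> Jj; rewrite /c /P /Q /= odd_double/= uphalf_double.
exists M, P, Q, double, e'; split.
- split.
  + by move=> i ali; rewrite /M /P /= odd_double doubleK; split=> //; exact: alA.
  + by move=> i j _ _; exact: double_inj.
  + move=> m; rewrite /M /P /=; case: ifPn => [_ /wA //|om alm _].
    by exists m./2 => //; rewrite -[RHS]odd_double_half (negbTE om).
  + by move=> i _; rewrite /P odd_double doubleK.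
- split.
  + move=> j bej; split; first exact: TM (e'T j bej).
    by rewrite (TQ j)//; [exact: beA|exact: e'T].
  + by move=> i j bei bej eij; apply: Tfun (e'T i bei) _; rewrite eij; exact: e'T.
  + move=> m Mm nQ.
    have [j bej Tjm] : exists2 j, fs_idx be j & T j m.
      move: Mm nQ; rewrite /M /Q /T /=; case: ifP => _.
        by move=> Jm _; exists m./2 => //; case: Jm.
      move=> alm; have [Km|nKm] := pselect (K m./2).
        by rewrite asboolT// => _; exists (phi m./2) => //; exact: phiJ.
      by rewrite asboolF// => nA; exfalso; apply: nA; exact: zA.
    by exists j => //; apply: Tinj (e'T j bej) Tjm.
  + by move=> j bej; rewrite (TQ j)//; exact: e'T.
- rewrite /matching_cost (eq_lp_cost _ _ _ _ _ _ _ _ _ _ cK cI cJ).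
  have sinj (S : set nat) (f : nat -> nat) : injective f -> set_inj S f.
    by move=> fI x y _ _ /fI.
  rewrite (lp_cost_images p K _ _ double double (fun j => j.*2.+1) c) ?ME//.
  + by apply: sinj; exact: double_inj.
  + by apply: sinj; exact: double_inj.
  + by apply: sinj => i j [] /double_inj.
  + by apply/disj_setPS => _ [[i Ki <-] [j [_ nKj] /double_inj ji]]; apply: nKj; rewrite ji.
  + apply/disj_setPS => m [].
    by move=> [[i _ <-]|[i _ <-]] [j _] /(congr1 odd) /=; rewrite !odd_double.
(* Used with [B] everything to see that [M] is finite for finite sums, and with [B] the values at
   least [del] when [p = +oo]. *)
- move=> B finK finI finJ.
  have := conj (conj (finite_image double finK) (finite_image double finI))
    (finite_image (fun j => j.*2.+1) finJ).
  rewrite -!finite_setU; apply: sub_finite_set => m /= [+ Bm].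
  rewrite {1}ME => -[[[k Kk km]|[i Ii im]]|[j Jj jm]].
  + by left; left; exists k => //; split=> //; rewrite cK// km.
  + by left; right; exists i => //; split=> //; rewrite cI// im.
  + by right; exists j => //; split=> //; rewrite cJ// jm.
Qed.

(** The [m]-th point never leaves the ball of radius [L m] about [P m], so [S] has to be stable only
    under such displacements [Y]. *)
Lemma path_of_family (S : set (fsum X)) al be M P Q (L : nat -> R) e e' :
  length_space setT d -> S al -> S be ->
  represents A al M P e -> represents A be M Q e' ->
  (forall m, (0 <= L m)%R) -> (forall m, M m -> d (P m) (Q m) < (L m)%:E) ->
  (forall Y, (forall m, M m -> d (P m) (Y m) <= (L m)%:E) ->
     S (FSum [set m | M m /\ ~ A (Y m)] Y)) ->
  lp_norm p M (EFin \o L) < +oo ->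
  exists g : R -> fsum X, [/\ is_path_in (Wp d A p) S g, g 0%R = al, g 1%R = be &
    path_length (Wp d A p) g <= lp_norm p M (EFin \o L)].
Proof.
move=> dL Sal Sbe repP repQ L0 PQL YS Nfin.
have /choice[G GP] : forall m, exists h : R -> X, [/\ h 0%R = P m, h 1%R = Q m &
    M m -> forall s t, unit_int s -> unit_int t -> d (h s) (h t) <= (L m * `|s - t|)%:E].
  move=> m; have [Mm|nMm] := pselect (M m).
    by have [h [h0 h1 hL]] := lipschitz_path d dM _ _ _ dL (PQL m Mm); exists h.
  (* A default outside [M], with the right ends so that [G0] and [G1] are equalities of
     functions. *)
  exists (fun t => if t == 1%R then Q m else P m); split=> //.
    by rewrite eq_sym oner_eq0.
  by rewrite eqxx.
have G0 : G ^~ 0%R = P by apply/funext => m; case: (GP m).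
have G1 : G ^~ 1%R = Q by apply/funext => m; case: (GP m).
apply: (path_of_lipschitz_family d A p dM p1 S al be M L G e e') => //.
- by rewrite G0.
- by rewrite G1.
- by move=> m s t Mm; case: (GP m) => _ _; exact.
move=> t tI; apply: YS => m Mm; case: (GP m) => <- _ /(_ Mm 0%R t) GL.
have /andP[t0 t1] := tI.
apply: (le_trans (GL _ tI)); first by rewrite /unit_int lexx ler01.
by rewrite lee_fin sub0r normrN ger0_norm// ler_piMr.
Qed.

End FamilyOfMatching.

(** * Stability of the spaces of formal sums *)

Lemma finite_set_inj (T U : Type) (S : set T) (f : T -> U) (B : set U) :
  (forall x y, S x -> S y -> f x = f y -> x = y) -> (forall x, S x -> B (f x)) ->
  finite_set B -> finite_set S.
Proof.
move=> fI SB finB; have : finite_set (f @` S).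
  by apply: sub_finite_set finB => _ [x Sx <-]; exact: SB.
rewrite (eq_finite_set (inj_card_eq _))//.
by move=> x y /set_mem Sx /set_mem Sy; exact: fI.
Qed.

Section Distance.
Local Open Scope ring_scope.
Local Open Scope ereal_scope.
Context {R : realType} {X : Type} (d : X -> X -> \bar R) (A : set X).
Hypothesis (dM : is_metric d).

Let d_ge0 x y : 0 <= d x y. Proof. by case: dM. Qed.
Let dxx x : d x x = 0. Proof. by case: dM. Qed.
Let dC x y : d x y = d y x. Proof. by case: dM. Qed.
Let d_tri x y z : d x z <= d x y + d y z. Proof. by case: dM. Qed.

Lemma dist_set_ge0 x : 0 <= dist_set d A x.
Proof. by apply: le_ereal_inf_tmp => _ [a _ <-]. Qed.

Lemma dist_set0 x : A x -> dist_set d A x = 0.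
Proof.
move=> Ax; apply/eqP; rewrite eq_le dist_set_ge0 andbT.
by apply: ereal_inf_lbound; exists x.
Qed.

Lemma dist_set_gt0 x : closed_for d A -> ~ A x -> 0 < dist_set d A x.
Proof.
move=> Acl nAx; rewrite lt_def dist_set_ge0 andbT; apply/eqP => dx0.
apply: nAx; apply: Acl => e e0.
have : dist_set d A x < e%:E by rewrite dx0.
by move=> /ereal_inf_lt[_ [a Aa <-] ae]; exists a.
Qed.

Lemma dist_set_tri x y (l : R) : d x y <= l%:E ->
  dist_set d A x <= l%:E + dist_set d A y.
Proof.
move=> xyl; rewrite addeC -leeBlDr//; apply: le_ereal_inf_tmp => _ [a Aa <-].
rewrite leeBlDr//; apply: (@le_trans _ _ (d x a)).
  by apply: ereal_inf_lbound; exists a.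
by apply: (le_trans (d_tri _ y _)); rewrite addeC; apply: leeD.
Qed.

(** A finite displacement does not change whether the distance to [A] is infinite, so the part at
    infinite distance stays finite. Elsewhere [Y m] is matched to the point of [A] assigned to
    [P m], at cost at most [L m] plus the old cost, and both have summable [r]-th powers. *)
Lemma Dbar_p_finite (r : R) al M P e (L : nat -> R) Y : (1 <= r)%R ->
  Dbar_p d A r%:E al -> represents A al M P e ->
  (forall m, (0 <= L m)%R) -> lp_norm r%:E M (EFin \o L) < +oo ->
  (forall m, M m -> d (P m) (Y m) <= (L m)%:E) ->
  Dbar_p d A r%:E (FSum [set m | M m /\ ~ A (Y m)] Y).
Proof.
move=> r1 [_ [alfin alW]] [eM eI eS eP] L0 Lfin PY.
have r0 : (0 < r)%R by exact: lt_le_trans r1.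
have distY m : M m -> dist_set d A (P m) = +oo -> dist_set d A (Y m) = +oo.
  move=> Mm Poo; apply/eqP; rewrite -leye_eq leNgt; apply/negP => Yfin.
  have := dist_set_tri _ _ _ (PY m Mm); rewrite Poo leye_eq => /eqP Loo.
  by have := lte_add_pinfty (ltry (L m)) Yfin; rewrite Loo ltxx.
have distP m : M m -> dist_set d A (Y m) = +oo -> dist_set d A (P m) = +oo.
  move=> Mm Yoo; apply/eqP; rewrite -leye_eq leNgt; apply/negP => Pfin.
  have YP : d (Y m) (P m) <= (L m)%:E by rewrite dC PY.
  have := dist_set_tri _ _ _ YP; rewrite Yoo leye_eq => /eqP Loo.
  by have := lte_add_pinfty (ltry (L m)) Pfin; rewrite Loo ltxx.
split; first by move=> m [].
split.
  apply: sub_finite_set (finite_image e alfin) => m /= [[Mm Ym]].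
  rewrite leye_eq => /eqP /(distP m Mm) Poo.
  have nP : ~ A (P m) by move=> /dist_set0; rewrite Poo.
  have [i ali eim] := eS m Mm nP; exists i => //; split=> //.
  by rewrite eP// eim Poo.
move: alW => /ereal_inf_lt[_ [K [phi [z [w [[_ _ K0 zA _] ->]]]]] costK].
(* The index set of [zero_like] is empty, so every point is matched to [A]. *)
have {}K0 k : ~ K k by exact: K0.
pose l := [set i | fs_idx al i /\ dist_set d A (fs_pt al i) < +oo].
have {}zA i : l i -> A (z i) by move=> li; apply: zA.
have sumz : \esum_(i in l) poweR (d (fs_pt al i) (z i)) r < +oo.
  have p0 c S : 0 <= \esum_(i in S) poweR (c i) r.
    by apply: esum_ge0 => *; exact: poweR_ge0.
  have rV0 : (r^-1 != 0)%R by rewrite invr_eq0 gt_eqF.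
  have := lty_poweRy rV0 costK.
  apply: le_lt_trans; apply: (@le_trans _ _ (\esum_(i in l `\` K) poweR (d (fs_pt al i) (z i)) r)).
    by apply: esum_subset => i li; split=> //; exact: K0.
  by rewrite -addeA (addeCA (esum K _)) leeDl// adde_ge0.
have [u uP] : exists u : nat -> nat, forall m, M m -> ~ A (P m) ->
    fs_idx al (u m) /\ e (u m) = m.
  suff /choice[u uP] : forall m, exists i, M m -> ~ A (P m) -> fs_idx al i /\ e i = m.
    by exists u.
  move=> m; have [[Mm nP]|nMP] := pselect (M m /\ ~ A (P m)).
    by have [i ali eim] := eS m Mm nP; exists i.
  by exists 0%N => Mm nP; exfalso; apply: nMP.
(* If [P m] lies in [A] it is no point of [al], and it serves as its own target at cost [0]. *)
pose a m := if `[< A (P m) >] then P m else z (u m).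
set F := FSum _ Y.
set I := fs_idx (l_res d A +oo F).
have lu m : I m -> ~ A (P m) -> l (u m).
  move=> [[Mm nY] Yfin] nP; have [alu eum] := uP m Mm nP; split=> //.
  rewrite eP// eum ltNge leye_eq; apply/eqP => /(distY m Mm) Yoo.
  by rewrite Yoo ltxx in Yfin.
have aA m : I m -> A (a m).
  move=> Im; rewrite /a; case: asboolP => // nP.
  exact/zA/lu.
pose c m := d (P m) (a m).
have c0 m : 0 <= c m by exact: d_ge0.
have cz : \esum_(m in I) poweR (c m) r <= \esum_(i in l) poweR (d (fs_pt al i) (z i)) r.
  rewrite (esumID [set m | A (P m)]); last by move=> *; exact: poweR_ge0.
  rewrite esum1 ?add0e; last first.
    by move=> m [_ /= AP]; rewrite /c /a asboolT// dxx poweR0r// gt_eqF.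
  have -> : \esum_(i in l) poweR (d (fs_pt al i) (z i)) r =
      \esum_(m in e @` l) poweR (c m) r.
    rewrite esum_image; last by move=> i j /set_mem[ali _] /set_mem[alj _]; exact: eI.
    apply: eq_esum => i [ali _]; have [Mi nPi] := eM i ali.
    have [alu eu] := uP _ Mi nPi.
    by rewrite /c /a asboolF// -eP// (eI _ _ alu ali eu).
  apply: esum_subset => m [Im nP]; exists (u m); first exact: lu.
  by have [[Mm _] _] := Im; have [] := uP m Mm nP.
apply: (@le_lt_trans _ _ (matching_cost d r%:E (l_res d A +oo F) (zero_like F) set0 id a a)).
  apply: ereal_inf_lbound; exists set0, id, a, a; split=> //.
  by split=> // [m [Im _]|m []//]; exact: aA.
apply: poweR_lty; rewrite /= esum_set0 add0e.
rewrite [X in _ + X](_ : _ = 0); last by rewrite set0D esum_set0.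
rewrite adde0 setD0 -/I.
apply: (@le_lt_trans _ _ (\esum_(m in I) (poweR 2%:E r * (poweR (L m)%:E r + poweR (c m) r)))).
  apply: le_esum => m [[Mm _] _].
  apply: le_trans (poweRD_le _ _ _ (ltW r0) _ _); rewrite ?lee_fin//.
  apply: ler_poweR; [exact: ltW|by []|].
  by apply: (le_trans (d_tri _ (P m) _)); apply: leeD => //; rewrite dC PY.
apply: (@le_lt_trans _ _ (poweR 2%:E r * \esum_(m in I) (poweR (L m)%:E r + poweR (c m) r))).
  apply: le_esumZ => [|m]; first exact: poweR_ge0.
  by apply: adde_ge0; exact: poweR_ge0.
rewrite esumD; [|by move=> *; exact: poweR_ge0..].
apply: lte_mul_pinfty; rewrite ?poweR_ge0//.
apply: lte_add_pinfty; last exact: le_lt_trans cz sumz.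
have rV0 : (r^-1 != 0)%R by rewrite invr_eq0 gt_eqF.
apply: le_lt_trans (lty_poweRy rV0 Lfin).
by apply: esum_subset => m [[]].
Qed.

(** If [Y m] is at distance at least [del] from [A], then [L m] or the distance from [P m] to [A] is
    at least [del / 2]; each happens for finitely many indices. *)
Lemma Dbar_p_infinite al M P e (L : nat -> R) Y :
  Dbar_p d A +oo al -> represents A al M P e ->
  (forall del : R, (0 < del)%R -> finite_set [set m | M m /\ (del <= L m)%R]) ->
  (forall m, M m -> d (P m) (Y m) <= (L m)%:E) ->
  Dbar_p d A +oo (FSum [set m | M m /\ ~ A (Y m)] Y).
Proof.
move=> [_ alfin] [eM eI eS eP] Lfin PY; split=> [m []//|del del0].
have del20 : (0 < del / 2)%R by rewrite divr_gt0.
have := conj (Lfin _ del20) (finite_image e (alfin _ del20)).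
rewrite -finite_setU; apply: sub_finite_set => m /= [[Mm _] delY].
have [Lm|Lm] := leP (del / 2)%R (L m); [by left|right].
have YP : d (Y m) (P m) <= (L m)%:E by rewrite dC PY.
have Pdel : (del / 2)%:E <= dist_set d A (P m).
  rewrite leNgt; apply/negP => Pdel.
  have : del%:E < del%:E; last by rewrite ltxx.
  apply: le_lt_trans (le_trans delY (dist_set_tri _ _ _ YP)) _.
  have -> : del%:E = (del / 2)%:E + (del / 2)%:E by rewrite -EFinD; congr EFin; lra.
  by apply: lteD => //; rewrite lte_fin.
have nP : ~ A (P m).
  by move=> /dist_set0 P0; rewrite P0 lee_fin leNgt del20 in Pdel.
have [i ali eim] := eS m Mm nP; exists i => //; split=> //.
by rewrite eP// eim.
Qed.

(* Pairs of points both close to [A] are split and matched to [A] instead, so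
   that only finitely many costs exceed any given threshold. Without this, the
   paths joining such pairs could stray far away from [A]. *)
Lemma matching_vanishing_cost al be K phi z w (e : R) :
  closed_for d A -> Dbar_p d A +oo al -> Dbar_p d A +oo be ->
  is_matching A al be K phi z w -> (0 < e)%R ->
  exists K' z' w', [/\ is_matching A al be K' phi z' w',
    matching_cost d +oo al be K' phi z' w' <= matching_cost d +oo al be K phi z w + e%:E &
    forall del : R, (0 < del)%R -> [/\
      finite_set [set k | K' k /\ del%:E <= d (fs_pt al k) (fs_pt be (phi k))],
      finite_set [set i | (fs_idx al `\` K') i /\ del%:E <= d (fs_pt al i) (z' i)] &
      finite_set [set j | (fs_idx be `\` phi @` K') j /\ del%:E <= d (w' j) (fs_pt be j)]]].
Proof.
move=> Acl [alA alfin] [beA befin] [KI phiI phiJ zA wA] e0.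
have e20 : (0 < e / 2)%R by rewrite divr_gt0.
pose near x := dist_set d A x < (e / 2)%:E.
(* The distance from [x] to [A] is positive, as [A] is closed, and finite, so some point of [A] is
   closer than twice that distance. The threshold [e / 2] makes the cost of matching [x] to it at
   most [e]. *)
have [n nP] : exists n : X -> X, forall x, ~ A x -> near x ->
    A (n x) /\ d x (n x) < dist_set d A x + dist_set d A x.
  suff /choice[n nP] : forall x, exists y, ~ A x -> near x ->
      A y /\ d x y < dist_set d A x + dist_set d A x by exists n.
  move=> x; have [[nAx nx]|nAn] := pselect (~ A x /\ near x); last first.
    by exists x => nAx nx; exfalso; apply: nAn.
  have : dist_set d A x < dist_set d A x + dist_set d A x.
    rewrite lteDl//; first exact: dist_set_gt0.
    by rewrite ge0_fin_numE ?dist_set_ge0// (lt_trans nx)// ltry.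
  by move=> /ereal_inf_lt[_ [y Ay <-] yd]; exists y.
have n_lt_e x : ~ A x -> near x -> d x (n x) <= e%:E.
  move=> nAx nx; have [_ /ltW dn] := nP x nAx nx; apply: le_trans dn _.
  have -> : e%:E = (e / 2)%:E + (e / 2)%:E by rewrite -EFinD; congr EFin; lra.
  by apply: leeD; exact: ltW.
have n_far del x : ~ A x -> near x -> del%:E <= d x (n x) ->
    (del / 2)%:E <= dist_set d A x.
  move=> nAx nx deln; have [_ dn] := nP x nAx nx.
  rewrite leNgt; apply/negP => ddel; have : del%:E < del%:E; last by rewrite ltxx.
  apply: le_lt_trans deln _; apply: lt_trans dn _.
  have -> : del%:E = (del / 2)%:E + (del / 2)%:E by rewrite -EFinD; congr EFin; lra.
  exact: lteD.
pose K' := [set k | K k /\ ~ (near (fs_pt al k) /\ near (fs_pt be (phi k)))].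
pose z' i := if `[< near (fs_pt al i) >] then n (fs_pt al i) else z i.
pose w' j := if `[< near (fs_pt be j) >] then n (fs_pt be j) else w j.
(* Only pairs with two near ends are split, so a far point unmatched by [K'] was unmatched by [K]
   and keeps its point of [A]. *)
have farI i : (fs_idx al `\` K') i -> ~ near (fs_pt al i) -> (fs_idx al `\` K) i.
  by move=> [ali nK'i] nx; split=> // Ki; apply: nK'i; split=> // -[].
have farJ j : (fs_idx be `\` phi @` K') j -> ~ near (fs_pt be j) ->
    (fs_idx be `\` phi @` K) j.
  move=> [bej nK'j] nx; split=> // -[k Kk kj]; apply: nK'j; exists k => //.
  by split=> //; rewrite kj => -[].
exists K', z', w'; split.
- split.
  + by move=> k [/KI].
  + by move=> k1 k2 [? _] [? _]; exact: phiI.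
  + by move=> k [/phiJ].
  + move=> i Ii; rewrite /z'; case: asboolP => [nx|fx]; last exact/zA/farI.
    by apply: (nP _ _ nx).1; apply: alA; case: Ii.
  + move=> j Jj; rewrite /w'; case: asboolP => [nx|fx]; last exact/wA/farJ.
    by apply: (nP _ _ nx).1; apply: beA; case: Jj.
- set C := matching_cost _ _ _ _ K _ _ _.
  have C0 : 0 <= C by apply: ereal_sup_ubound; do 3 left.
  have Ce x : x <= C -> x <= C + e%:E.
    by move=> xC; rewrite (le_trans xC)// leeDl// lee_fin ltW.
  apply: ge_ereal_sup => _ [[[->|[k [Kk _] <-]]|[i Ii <-]]|[j Jj <-]].
  + exact: Ce.
  + by apply: Ce; apply: ereal_sup_ubound; left; left; right; exists k.
  + rewrite /z'; case: asboolP => [nx|fx].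
      apply: le_trans (n_lt_e _ _ nx) _; first by apply: alA; case: Ii.
      by rewrite leeDr.
    apply: Ce; apply: ereal_sup_ubound; left; right; exists i => //; exact: farI.
  + rewrite /w'; case: asboolP => [nx|fx].
      rewrite dC; apply: le_trans (n_lt_e _ _ nx) _; first by apply: beA; case: Jj.
      by rewrite leeDr.
    apply: Ce; apply: ereal_sup_ubound; right; exists j => //; exact: farJ.
(* A pair kept by [K'] has an end at distance at least [e / 2] from [A], so such pairs are finite in
   number whatever their cost. An unmatched point of cost at least [del] is either far or, by
   [n_far], at distance at least [del / 2]. *)
move=> del del0; have del20 : (0 < del / 2)%R by rewrite divr_gt0.
have farE x : ~ near x -> (e / 2)%:E <= dist_set d A x by move/negP; rewrite -leNgt.
split.
- pose K1 := [set k | K k /\ fs_idx (u_res d A (e / 2)%:E be) (phi k)].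
  have finK1 : finite_set K1.
    apply: (@finite_set_inj _ _ _ phi _ _ _ (befin _ e20)).
      by move=> k1 k2 [? _] [? _]; exact: phiI.
    by move=> k [].
  have := conj (alfin _ e20) finK1; rewrite -finite_setU.
  apply: sub_finite_set => k [[Kk nn] _].
  have [nx|fx] := pselect (near (fs_pt al k)); last first.
    by left; split; [exact: KI|exact: farE].
  right; split=> //; split; first exact: phiJ.
  by apply: farE => ny; apply: nn.
- have := conj (alfin _ e20) (alfin _ del20); rewrite -finite_setU.
  apply: sub_finite_set => i [[ali _]]; rewrite /z'.
  case: asboolP => [nx dn|fx _]; last by left; split=> //; exact: farE.
  by right; split=> //; apply: n_far dn => //; exact: alA.
- have := conj (befin _ e20) (befin _ del20); rewrite -finite_setU.
  apply: sub_finite_set => j [[bej _]]; rewrite /w'.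
  case: asboolP => [nx dn|fx _]; last by left; split=> //; exact: farE.
  by right; split=> //; apply: n_far => //; [exact: beA|rewrite dC].
Qed.

End Distance.

(** * Length space property for finite [p], for [p = +oo], and for finite sums *)

Section LengthSpaces.
Context {R : realType} {X : Type} (d : X -> X -> \bar R) (A : set X).
Hypotheses (dM : is_metric d) (Acl : closed_for d A) (dL : length_space setT d).

Let d_ge0 x y : 0 <= d x y. Proof. by case: dM. Qed.

Lemma Wp_adherent (p : \bar R) al be (e : R) : Wp d A p al be < +oo -> (0 < e)%R ->
  exists K phi z w, is_matching A al be K phi z w /\
    matching_cost d p al be K phi z w < Wp d A p al be + e%:E.
Proof.
move=> Woo e0.
have Wfin : Wp d A p al be \is a fin_num by rewrite ge0_fin_numE// Wp_ge0.
have [_ [K [phi [z [w [mK ->]]]]] cK] := lb_ereal_inf_adherent e0 Wfin.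
by exists K, phi, z, w.
Qed.

Lemma length_space_Dbar_p_finite (r : R) : (1 <= r)%R ->
  length_space (Dbar_p d A r%:E) (Wp d A r%:E).
Proof.
move=> r1; apply: length_spaceP => [|al be e Sal Sbe Woo e0]; first exact: Wp_ge0.
(* One half of [e] pays for the matching, the other for the paths. *)
have e20 : (0 < e / 2)%R by rewrite divr_gt0.
have [K [phi [z [w [mK cK]]]]] := Wp_adherent _ _ _ _ Woo e20.
have [M [P [Q [f [f' [repP repQ normE _]]]]]] :=
  family_of_matching d A r%:E dM al be K phi z w Sal.1 Sbe.1 mK.
have Woo' : Wp d A r%:E al be + (e / 2)%:E < +oo by rewrite lte_add_pinfty// ltry.
have Noo : lp_norm r%:E M (fun m => d (P m) (Q m)) < +oo by rewrite normE (lt_trans cK).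
have [L [PQL L0 normL]] := lp_norm_perturb r M _ (e / 2) r1 (fun m => d_ge0 _ _) Noo e20.
have Loo : lp_norm r%:E M (EFin \o L) < +oo.
  by apply: le_lt_trans normL _; rewrite lte_add_pinfty// ltry.
have [|g [gP g0 g1 gl]] := path_of_family d A r%:E dM r1 _ al be M P Q L f f'
    dL Sal Sbe repP repQ L0 PQL _ Loo.
  by move=> Y PY; exact: Dbar_p_finite repP L0 Loo PY.
exists g; split=> //; apply: le_trans gl (le_trans normL _).
rewrite [e in leRHS](splitr e) EFinD addeA leeD2r// normE; exact: ltW.
Qed.

Lemma length_space_Dbar_p_infinite :
  length_space (Dbar_p d A +oo) (Wp d A +oo).
Proof.
apply: length_spaceP => [|al be e Sal Sbe Woo e0]; first exact: Wp_ge0.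
have p1 : 1 <= +oo :> \bar R by rewrite leey.
(* One third each for the choice of a matching, for making its costs vanish, and for the paths. *)
have e30 : (0 < e / 3)%R by rewrite divr_gt0.
have [K0 [phi [z0 [w0 [mK0 cK0]]]]] := Wp_adherent _ _ _ _ Woo e30.
have [K [z [w [mK cK van]]]] :=
  matching_vanishing_cost d A dM _ _ _ _ _ _ _ Acl Sal Sbe mK0 e30.
have [M [P [Q [f [f' [repP repQ normE fin]]]]]] :=
  family_of_matching d A +oo dM al be K phi z w Sal.1 Sbe.1 mK.
have cW : lp_norm +oo M (fun m => d (P m) (Q m)) <= Wp d A +oo al be + (e / 3 + e / 3)%:E.
  rewrite normE; apply: le_trans cK _; rewrite EFinD addeA leeD2r//; exact: ltW.
have Noo : lp_norm +oo M (fun m => d (P m) (Q m)) < +oo.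
  by apply: le_lt_trans cW _; rewrite lte_add_pinfty// ltry.
have [L [PQL L0 normL finL]] : exists L : nat -> R, [/\ forall m, M m -> d (P m) (Q m) < (L m)%:E,
    forall m, (0 <= L m)%R,
    lp_norm +oo M (EFin \o L) <= lp_norm +oo M (fun m => d (P m) (Q m)) + (e / 3)%:E &
    forall del : R, (0 < del)%R -> finite_set [set m | M m /\ (del <= L m)%R]].
  apply: sup_norm_perturb => // del del0; have [vK vI vJ] := van del del0.
  exact: (fin [set x | del%:E <= x]).
have Loo : lp_norm +oo M (EFin \o L) < +oo.
  by apply: le_lt_trans normL _; rewrite lte_add_pinfty// ltry.
have [|g [gP g0 g1 gl]] := path_of_family d A +oo dM p1 _ al be M P Q L f f'
    dL Sal Sbe repP repQ L0 PQL _ Loo.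
  by move=> Y PY; exact: Dbar_p_infinite repP finL PY.
exists g; split=> //; apply: le_trans gl (le_trans normL _).
have -> : e%:E = (e / 3 + e / 3)%:E + (e / 3)%:E by rewrite -EFinD; congr EFin; lra.
by rewrite addeA leeD2r.
Qed.

(** A matching of finite sums gives a finite [M], and every displacement of a finite family is a
    finite sum. *)
Lemma length_space_Dfin (p : \bar R) : 1 <= p -> length_space (Dfin A) (Wp d A p).
Proof.
move=> p1; apply: length_spaceP => [|al be e Sal Sbe Woo e0]; first exact: Wp_ge0.
have e20 : (0 < e / 2)%R by rewrite divr_gt0.
have [K [phi [z [w [mK cK]]]]] := Wp_adherent _ _ _ _ Woo e20.
have [M [P [Q [f [f' [repP repQ normE fin]]]]]] :=
  family_of_matching d A p dM al be K phi z w Sal.1 Sbe.1 mK.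
have finM : finite_set M.
  have finI : finite_set (fs_idx al) := Sal.2.
  have finJ : finite_set (fs_idx be) := Sbe.2.
  suff : finite_set [set m | M m /\ setT (d (P m) (Q m))].
    by apply: sub_finite_set.
  apply: fin.
  - by apply: sub_finite_set finI => k [Kk _]; case: mK => + _ _ _ _; exact.
  - by apply: sub_finite_set finI => k [[]].
  - by apply: sub_finite_set finJ => k [[]].
have Woo' : Wp d A p al be + (e / 2)%:E < +oo by rewrite lte_add_pinfty// ltry.
have Noo : lp_norm p M (fun m => d (P m) (Q m)) < +oo by rewrite normE (lt_trans cK).
have [L [PQL L0 normL]] : exists L : nat -> R, [/\ forall m, M m -> d (P m) (Q m) < (L m)%:E,
    forall m, (0 <= L m)%R &
    lp_norm p M (EFin \o L) <= lp_norm p M (fun m => d (P m) (Q m)) + (e / 2)%:E].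
  case: (lep1 p p1) Noo => [[r r1 ->]|->] Noo; first exact: lp_norm_perturb.
  have [|L [? ? ? _]] := sup_norm_perturb M _ _ (fun m => d_ge0 (P m) (Q m)) Noo e20.
    by move=> del del0; apply: sub_finite_set finM => m [].
  by exists L.
have Loo : lp_norm p M (EFin \o L) < +oo.
  by apply: le_lt_trans normL _; rewrite lte_add_pinfty// ltry.
have [|g [gP g0 g1 gl]] := path_of_family d A p dM p1 _ al be M P Q L f f'
    dL Sal Sbe repP repQ L0 PQL _ Loo.
  move=> Y _; split; first by move=> m [].
  by apply: sub_finite_set finM => m [].
exists g; split=> //; apply: le_trans gl (le_trans normL _).
rewrite [e in leRHS](splitr e) EFinD addeA leeD2r// normE; exact: ltW.
Qed.

End LengthSpaces.

Theorem theorem5p6 (R : realType) (X : Type) (d : X -> X -> \bar R) (A : set X)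
  (p : \bar R) :
  is_metric d -> closed_for d A -> length_space setT d -> 1 <= p ->
  length_space (Dbar_p d A p) (Wp d A p) /\ length_space (Dfin A) (Wp d A p).
Proof.
move=> dM Acl dL p1; split; last exact: length_space_Dfin.
have [[r r1 ->]|->] := lep1 p p1; first exact: length_space_Dbar_p_finite.
exact: length_space_Dbar_p_infinite.
Qed.
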